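(* Let $n\ge 1$ be an integer, let $q$ be a prime power, and let $M=(a_{i,j})\in \mathrm{U}(n,\mathbb{F}_q)$. Then $\mathrm{fr}(M)=1$ if and only if $M$ is diagonal and has exactly one nonzero diagonal entry. In particular, $s_q(n,1)=n(q-1)$.
   Context: $\mathbb{F}_q$ is the finite field with $q$ elements. $\mathrm{U}(n,\mathbb{F}_q)$ is the $\mathbb{F}_q$-vector space of $n\times n$ upper triangular matrices over $\mathbb{F}_q$ (entries $m_{i,j}=0$ whenever $i>j$). For $M\in \mathrm{U}(n,\mathbb{F}_q)$ and $1\le i\le n$, $M_{[i]}$ is the $i\times(n-i+1)$ submatrix of $M$ obtained by deleting the first $i-1$ columns and the last $n-i$ rows (i.e. rows $1,\dots,i$ and columns $i,\dots,n$). The flag-rank weight of $M$ is $\mathrm{fr}(M)=\sum_{i=1}^{n}\mathrm{rk}(M_{[i]})$. The number $s_q(n,t)$ is the size of the flag-rank sphere of radius $t$: $s_q(n,t)=|\{A\in \mathrm{U}(n,\mathbb{F}_q):\mathrm{fr}(A)=t\}|$. *)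

(* Defs.v *)
From HB Require Import structures.
From mathcomp Require Import all_boot all_order all_algebra.

Set Implicit Arguments.
Unset Strict Implicit.
Unset Printing Implicit Defensive.

Import GRing.Theory.
Local Open Scope ring_scope.

(* MathComp's [is_trig_mx] means lower triangular, so it is not used here. *)
Definition upper_mx (F : finFieldType) (n : nat) : {set 'M[F]_n} :=
  [set M : 'M[F]_n | [forall i : 'I_n, forall j : 'I_n, (j < i)%N ==> (M i j == 0)]].

Fact shift_col_subproof (n : nat) (i : 'I_n) (b : 'I_(n - i)) : (i + b < n)%N.
Proof. by rewrite -ltn_subRL. Qed.

Definition shift_col (n : nat) (i : 'I_n) (b : 'I_(n - i)) : 'I_n :=
  Ordinal (shift_col_subproof b).

(* Indices start at 0: for i : 'I_n this is the block M_[i+1] of the usual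
   1-based numbering, with rows 0, ..., i and columns i, ..., n-1 of M. *)
Definition flag_submx (F : fieldType) (n : nat) (M : 'M[F]_n) (i : 'I_n) :
    'M[F]_(i.+1, n - i) :=
  mxsub (widen_ord (ltn_ord i)) (@shift_col n i) M.

Definition flag_rank (F : fieldType) (n : nat) (M : 'M[F]_n) : nat :=
  (\sum_(i < n) \rank (flag_submx M i))%N.

Definition flag_sphere_size (F : finFieldType) (n t : nat) : nat :=
  #|[set A in upper_mx F n | flag_rank A == t]|.

(* Main.v *)
(* An entry M r c of an upper triangular M lies in the blocks of index r, ..., c,
   so it contributes at least once to the rank of each of them. Flag rank 1
   therefore leaves room for diagonal entries only, and for a diagonal matrix the
   block of index i has the single possibly nonzero entry M i i. *)
Require Import Defs.
From mathcomp Require Import all_boot all_order all_algebra.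

Set Implicit Arguments.
Unset Strict Implicit.
Unset Printing Implicit Defensive.

Import GRing.Theory.
Local Open Scope ring_scope.

Section FlagRank.
Variables (F : fieldType) (n : nat).
Implicit Types (M : 'M[F]_n) (i r c : 'I_n).

(** The block of index [i] holds [M r c] at row [r] and column [c - i], so it is not the zero
    matrix. *)
Lemma flag_submx_rank_gt0 M i r c :
  (r <= i <= c)%N -> M r c != 0 -> (0 < \rank (flag_submx M i))%N.
Proof.
move=> /andP[le_ri le_ic]; apply: contraNT; rewrite -eqn0Ngt mxrank_eq0.
have lt_c : (c - i < n - i)%N by rewrite ltn_sub2r ?(leq_ltn_trans le_ic).
move=> /eqP/matrixP/(_ (Ordinal (le_ri : (r < i.+1)%N)) (Ordinal lt_c)).
rewrite !mxE => M0; rewrite -M0; apply/eqP.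
by congr (M _ _); apply: val_inj; rewrite //= subnKC.
Qed.

(** Rows up to [i] and columns from [i] on meet the diagonal only at [(i, i)], the bottom left
    corner of the block, so the block is [M i i] times a matrix unit. *)
Lemma flag_submx_rank_diag M i :
  is_diag_mx M -> \rank (flag_submx M i) = (M i i != 0).
Proof.
move=> /is_diag_mxP M_diag; have ni_gt0 : (0 < n - i)%N by rewrite subn_gt0.
have -> : flag_submx M i = M i i *: delta_mx ord_max (Ordinal ni_gt0).
  apply/matrixP => a b; rewrite !mxE -!val_eqE /=.
  (* The cases are the corner, the rest of the last row, the rest of the first column, and the
     positions with [a < i < i + b]. All but the corner lie off the diagonal of [M]. *)
  have [eq_ai|ne_ai] := eqVneq (a : nat) i; have [b0|b_neq0] := eqVneq (b : nat) 0%N.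
  - by rewrite mulr1; congr (M _ _); apply: val_inj; rewrite //= b0 addn0.
  - by rewrite mulr0 M_diag //= eq_ai -[X in X != _]addn0 eqn_add2l eq_sym.
  - by rewrite mulr0 M_diag //= b0 addn0.
  - have := leq_ord a => le_ai; rewrite mulr0 M_diag //=.
    by rewrite neq_ltn (leq_ltn_trans le_ai) // -[X in (X < _)%N]addn0 ltn_add2l lt0n.
have [->|Mii_neq0] := eqVneq (M i i) 0; first by rewrite scale0r mxrank0.
by rewrite mxrank_scale_nz // mxrank_delta.
Qed.

Lemma flag_rank_diag M :
  is_diag_mx M -> flag_rank M = #|[set i | M i i != 0]|.
Proof.
move=> M_diag; rewrite -sum1dep_card big_mkcond; apply: eq_bigr => i _.
by rewrite flag_submx_rank_diag //; case: (_ != _).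
Qed.

End FlagRank.

Lemma flag_rank1_diag (F : finFieldType) n (M : 'M[F]_n) :
  M \in upper_mx F n -> flag_rank M = 1%N -> is_diag_mx M.
Proof.
rewrite inE => /forallP M_upper fr1; apply/is_diag_mxP => r c ne_rc.
apply/eqP/contraT => Mrc_neq0.
have le_rc : (r <= c)%N.
  rewrite leqNgt; apply: contra Mrc_neq0 => lt_cr.
  exact: implyP (forallP (M_upper r) c) lt_cr.
(* The blocks of index [r] and [c] are distinct and both contain the nonzero entry, so together they
   contribute at least 2. *)
have rank_r := flag_submx_rank_gt0 (M := M) (i := r) (r := r) (c := c).
have rank_c := flag_submx_rank_gt0 (M := M) (i := c) (r := r) (c := c).
rewrite !leqnn le_rc in rank_r rank_c.
have : (2 <= flag_rank M)%N.
  rewrite /flag_rank (bigD1 r) //= (bigD1 c) /=; last by rewrite eq_sym.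
  by rewrite addnA -(addn1 1) (leq_trans _ (leq_addr _ _)) // leq_add ?rank_r ?rank_c.
by rewrite fr1.
Qed.

Lemma flag_rank1P (F : finFieldType) n (M : 'M[F]_n) : M \in upper_mx F n ->
  flag_rank M = 1%N <-> is_diag_mx M /\ exists! i : 'I_n, M i i != 0.
Proof.
move=> M_upper; split=> [fr1|[M_diag [i [Mii_neq0 uniq_i]]]].
  have M_diag := flag_rank1_diag M_upper fr1; split=> //.
  (* The flag rank is now the size of the diagonal support, which is therefore a singleton. *)
  move: fr1; rewrite flag_rank_diag // => /eqP/cards1P[i /setP supp_M].
  exists i; split=> [|j Mjj_neq0]; first by have := supp_M i; rewrite !inE eqxx.
  by have := supp_M j; rewrite !inE Mjj_neq0 => /esym/eqP.
rewrite flag_rank_diag //; apply/eqP/cards1P; exists i; apply/setP => j.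
by rewrite !inE; apply/idP/eqP => [/uniq_i|->].
Qed.

Lemma diag_upper_mx (F : finFieldType) n (M : 'M[F]_n) :
  is_diag_mx M -> M \in upper_mx F n.
Proof.
move=> /is_diag_mxP M_diag; rewrite inE.
apply/forallP => i; apply/forallP => j; apply/implyP => lt_ji.
by rewrite M_diag // neq_ltn lt_ji orbT.
Qed.

(** Parametrizes the sphere by a diagonal position and a nonzero scalar, which reduces its count to
    injectivity. *)
Lemma flag_sphere1E (F : finFieldType) n :
  [set A in upper_mx F n | flag_rank A == 1%N] =
  [set u.2 *: delta_mx u.1 u.1 | u in setX [set: 'I_n] [set~ (0 : F)]].
Proof.
apply/setP => A; apply/setIdP/imsetP => [[A_upper /eqP]|].
  move=> /(flag_rank1P A_upper)[/is_diag_mxP A_diag [i [Aii_neq0 uniq_i]]].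
  exists (i, A i i); first by rewrite !inE.
  apply/matrixP => r c; rewrite !mxE /=.
  have [->|ne_rc] := eqVneq r c.
    have [->|ne_ci] := eqVneq c i; first by rewrite mulr1.
    (* A nonzero [A c c] would force [c = i] by uniqueness. *)
    by rewrite mulr0; apply/eqP; apply: contraNT ne_ci => /uniq_i->.
  rewrite A_diag //; case: eqP => [eq_ri|_]; last by rewrite mulr0.
  by rewrite -eq_ri eq_sym (negPf ne_rc) mulr0.
case=> -[i a] /setXP[_]; rewrite in_setC1 /= => a_neq0 ->{A}.
have A_diag : is_diag_mx (a *: delta_mx i i).
  apply/is_diag_mxP => r c ne_rc; rewrite !mxE.
  have [eq_ri|_] := eqVneq r i => /=; last by rewrite mulr0.
  by have [eq_ci|_] := eqVneq c i; [rewrite eq_ri eq_ci eqxx in ne_rc | rewrite mulr0].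
have A_upper := diag_upper_mx A_diag; split=> //; apply/eqP; apply/flag_rank1P=> //.
split=> //; exists i; split=> [|j]; first by rewrite !mxE eqxx mulr1.
by rewrite !mxE andbb; have [->|_] := eqVneq j i; rewrite // mulr0 eqxx.
Qed.

Theorem proposition3p1 (n q : nat) (F : finFieldType) (hn : (1 <= n)%N) (hq : #|F| = q) :
  (forall M : 'M[F]_n, M \in upper_mx F n ->
     (flag_rank M = 1%N <-> is_diag_mx M /\ (exists! i : 'I_n, M i i != 0)))
  /\ flag_sphere_size F n 1 = (n * (q - 1))%N.
Proof.
split=> [M|]; first exact: flag_rank1P.
rewrite /flag_sphere_size flag_sphere1E card_in_imset.
  by rewrite cardsX cardsT card_ord cardsC1 hq subn1.
(* Comparing the entries at [(i, i)] gives [a = b] if [i = j], and otherwise [a = 0], which is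
   excluded. *)
move=> [i a] [j b]; rewrite !inE /= => a_neq0 _ /matrixP/(_ i i).
rewrite !mxE !eqxx mulr1 andbb; have [->|_] := eqVneq i j; first by rewrite mulr1 => ->.
by rewrite mulr0 => a0; rewrite a0 eqxx in a_neq0.
Qed.
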